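(* Let $S \subseteq \mathbb{R}^d$ be such that $0 < \mathrm{width}(S) < \infty$. Then $\mathrm{conv}(S')$ is a non-empty, convex set that is centrally symmetric about the origin, and the origin is the only lattice point of $(\mathbb{Z}^d)^*$ in its relative interior. Moreover, the lattice points of $(\mathbb{Z}^d)^*$ on the relative boundary of $\mathrm{conv}(S')$ are precisely the elements of $S'$.
   Context: For non-empty $S \subseteq \mathbb{R}^d$, let $\mathcal{D}(S)$ be the set of linear functionals $v \in (\mathbb{R}^d)^*$ with $\sup v(S) < \infty$ and $\inf v(S) > -\infty$; for $v \in \mathcal{D}(S)$ put $\mathrm{width}(S,v) = \sup v(S) - \inf v(S)$. Let $\mathcal{L}(S) = \mathcal{D}(S) \cap (\mathbb{Z}^d)^*$. The lattice width of $S$ is $\mathrm{width}(S) = \inf\{\mathrm{width}(S,v) : v \in \mathcal{L}(S)\setminus\{0\}\}$ (equal to $\infty$ if this set is empty), and the set of lattice width directions is $S' = \{v \in \mathcal{L}(S)\setminus\{0\} : \mathrm{width}(S,v) = \mathrm{width}(S)\}$. *)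

(* Defs.v *)
From mathcomp Require Export all_boot all_order all_algebra.
From mathcomp Require Export all_classical all_reals all_analysis.

Set Implicit Arguments.
Unset Strict Implicit.
Unset Printing Implicit Defensive.

Import Order.TTheory GRing.Theory Num.Theory.
Import numFieldNormedType.Exports.

Local Open Scope classical_set_scope.
Local Open Scope ring_scope.

(* Points of R^d are column vectors; a linear functional v in (R^d)^* is the
   row vector representing it, acting on points by x |-> v *m x. *)
Definition pairing (R : realType) (d : nat) (v : 'rV[R]_d) (x : 'cV[R]_d) : R :=
  (v *m x) 0 0.

Definition int_lattice (R : realType) (d : nat) : set 'cV[R]_d :=
  [set x | forall i, x i 0 \is a Num.int].

(* (Z^d)^*, inside (R^d)^*: the functionals that map Z^d to Z. *)
Definition dual_lattice (R : realType) (d : nat) : set 'rV[R]_d :=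
  [set v | forall x, int_lattice x -> pairing v x \is a Num.int].

Definition bounded_functionals (R : realType) (d : nat) (S : set 'cV[R]_d) :
    set 'rV[R]_d :=
  [set v | has_ubound (pairing v @` S) /\ has_lbound (pairing v @` S)].

(* [sup] and [inf] are real-valued, so this is meaningful only for
   non-empty S and for v in [bounded_functionals S]. *)
Definition width (R : realType) (d : nat) (S : set 'cV[R]_d) (v : 'rV[R]_d) : R :=
  sup (pairing v @` S) - inf (pairing v @` S).

Definition bounded_lattice_functionals (R : realType) (d : nat)
    (S : set 'cV[R]_d) : set 'rV[R]_d :=
  bounded_functionals S `&` @dual_lattice R d.

(* The infimum of the empty set is +oo. *)
Definition lattice_width (R : realType) (d : nat) (S : set 'cV[R]_d) : \bar R :=
  ereal_inf [set (width S v)%:E | v in bounded_lattice_functionals S `\ 0].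

Definition lattice_width_directions (R : realType) (d : nat)
    (S : set 'cV[R]_d) : set 'rV[R]_d :=
  [set v | (bounded_lattice_functionals S `\ 0) v /\
           (width S v)%:E = lattice_width S].

Definition convex_hull (R : realType) (V : lmodType R) (A : set V) : set V :=
  smallest (@convex_set R V) A.

Definition affine_set (R : realType) (V : lmodType R) (A : set V) : Prop :=
  forall (x y : V) (t : R), A x -> A y -> A (t *: x + (1 - t) *: y).

Definition affine_hull (R : realType) (V : lmodType R) (A : set V) : set V :=
  smallest (@affine_set R V) A.

(* The interior of A in the subspace topology of its affine hull. *)
Definition relative_interior (R : realType) (V : normedModType R) (A : set V) :
    set V :=
  [set x | affine_hull A x /\ within (affine_hull A) (nbhs x) A].

(* The topological closure is the closure in the affine hull when V is
   finite-dimensional, since affine subspaces are then closed. *)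
Definition relative_boundary (R : realType) (V : normedModType R) (A : set V) :
    set V :=
  closure A `\` relative_interior A.

(* Main.v *)
(* Width is a seminorm on the functionals bounded on S, and the lattice width is
   its infimum over the nonzero vectors of the group L of bounded lattice
   functionals. If that infimum is positive, it is attained: for u in L of
   bounded width, simultaneous Dirichlet approximation of the coordinates of a
   small multiple of u in a basis taken from L yields a vector of L of width
   below the infimum, hence zero, and this bounds the coordinates of u, so that
   only finitely many u are possible. The convex hull K of the directions lies
   in the ball of radius width(S), so its nonzero lattice points all have width
   exactly width(S); pushing a relative interior point u to (1 + e) u stays in
   K, hence u has strictly smaller width, and u = 0 if u is a lattice point. *)
Require Import Defs.
From mathcomp Require Import lra ring zify.
Import Order.TTheory GRing.Theory Num.Theory.
Import numFieldNormedType.Exports.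
Local Open Scope classical_set_scope.
Local Open Scope ring_scope.

Set Implicit Arguments.
Unset Strict Implicit.
Unset Printing Implicit Defensive.

(** * Simultaneous Diophantine approximation, and bases chosen inside a set *)

(** Pigeonhole: among the multiples of [c] by [0, ..., Q ^ k], two have their fractional parts in
    the same one of [Q ^ k] cubes of side [1 / Q]; the difference of the two multipliers serves as
    [n]. *)
Lemma simultaneous_dirichlet (R : realType) (k Q : nat) (c : 'I_k -> R) :
  (0 < Q)%N ->
  exists n (a : 'I_k -> int),
    (0 < n <= Q ^ k)%N /\ forall i, `|n%:R * c i - (a i)%:~R| < Q%:R^-1.
Proof.
case: Q => // q _.
pose fl (n : nat) i := Num.floor (n%:R * c i).
pose fr (n : nat) i := n%:R * c i - (fl n i)%:~R.
have fr01 n i : 0 <= fr n i < 1.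
  by rewrite /fr /fl; have := floor_itv (n%:R * c i); rewrite rmorphD /=; lra.
(* The cube containing the fractional parts; the bound [tr] keeps [inord] away from its default
   value. *)
pose box (n : 'I_(q.+1 ^ k).+1) : {ffun 'I_k -> 'I_q.+1} :=
  [ffun i => inord (Num.trunc (q.+1%:R * fr n i))].
have q0 : 0 < q.+1%:R :> R by rewrite ltr0n.
have tr n i : (Num.trunc (q.+1%:R * fr n i) < q.+1)%N.
  have /andP[f0 f1] := fr01 n i.
  have p0 : 0 <= q.+1%:R * fr n i by apply: mulr_ge0 => //; exact: ltW.
  by rewrite truncn_lt_nat // gtr_pMr.
have [m [n [mn bmn]]] : exists m n : 'I_(q.+1 ^ k).+1,
    (m < n)%N /\ box m = box n.
  have : ~ injective box.
    by move=> /leq_card; rewrite card_ffun !card_ord ltnn.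
  move=> ninj; apply: contrapT => H; apply: ninj => x y xy.
  case: (ltngtP x y) => [h|h|/val_inj//]; exfalso; apply: H;
    first by exists x, y.
  by exists y, x.
exists (n - m)%N, (fun i => fl n i - fl m i); split.
  by have := ltn_ord n; move: mn; lia.
move=> i; have := congr1 (fun f : {ffun 'I_k -> 'I_q.+1} => val (f i)) bmn.
rewrite !ffunE /= !inordK // => E.
have itv (l : nat) : (Num.trunc (q.+1%:R * fr l i))%:R <= q.+1%:R * fr l i <
    (Num.trunc (q.+1%:R * fr l i))%:R + 1.
  rewrite natr1; apply: truncn_itv; case/andP: (fr01 l i) => ? _.
  by apply: mulr_ge0 => //; exact: ltW.
have {itv}close : `|q.+1%:R * (fr n i - fr m i)| < 1.
  have := itv m; have := itv n; rewrite E (mulrBr _ (fr n i)) ltr_norml.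
  lra.
have -> : (n - m)%:R * c i - (fl n i - fl m i)%:~R = fr n i - fr m i.
  by rewrite natrB ?(ltnW mn) // rmorphB /fr /=; ring.
by rewrite -[ltRHS]mul1r ltr_pdivlMr // mulrC -(ger0_norm (ltW q0)) -normrM.
Qed.

(** If no free family from [A] spanned [A], each could be enlarged within [A], eventually beyond the
    dimension of the space. *)
Lemma exists_free_spanning (K : fieldType) (vT : vectType K) (A : set vT) :
  exists k (b : k.-tuple vT),
    [/\ free b, forall i : 'I_k, A b`_i & forall v, A v -> v \in <<b>>%VS].
Proof.
apply: contrapT => H.
have: forall n, exists b : seq vT,
    [/\ size b = n, free b & forall u, u \in b -> A u].
  elim=> [|n [b [sb fb bA]]]; first by exists [::]; rewrite nil_free.
  have [v [Av vb]] : exists v, A v /\ v \notin <<b>>%VS.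
    apply: contrapT => h; apply: H; exists (size b), (in_tuple b); split => //=.
      by move=> i; apply: bA; apply: mem_nth.
    move=> v Av; apply/negPn/negP => vb; apply: h; by exists v.
  exists (v :: b); split; rewrite /= ?sb ?free_cons ?vb //.
  by move=> u; rewrite inE => /orP[/eqP->//|/bA].
move=> /(_ (\dim {:vT}).+1) [b [sb /eqP fb _]].
by have := dimvS (subvf <<b>>%VS); rewrite fb sb ltnn.
Qed.

(** * Functionals and their oscillation on a set *)

Section pairing.
Variables (R : realType) (d : nat).
Implicit Types (u v : 'rV[R]_d) (x y : 'cV[R]_d) (S : set 'cV[R]_d) (t : R).

Lemma pairingE v x : pairing v x = \sum_j v 0 j * x j 0.
Proof. by rewrite /pairing mxE. Qed.

Lemma pairingDl u v x : pairing (u + v) x = pairing u x + pairing v x.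
Proof. by rewrite /pairing mulmxDl mxE. Qed.

Lemma pairingZl (a : R) v x : pairing (a *: v) x = a * pairing v x.
Proof. by rewrite /pairing -scalemxAl mxE. Qed.

Lemma pairingNl v x : pairing (- v) x = - pairing v x.
Proof. by rewrite /pairing mulNmx mxE. Qed.

Lemma pairingBr v x y : pairing v (x - y) = pairing v x - pairing v y.
Proof. by rewrite /pairing mulmxBr !mxE. Qed.

Lemma normr_pairing_le v x t : (forall j, `|v 0 j| <= t) ->
  `|pairing v x| <= t * \sum_j `|x j 0|.
Proof.
move=> vt; rewrite pairingE (le_trans (ler_norm_sum _ _ _)) // mulr_sumr.
by apply: ler_sum => j _; rewrite normrM ler_wpM2r.
Qed.

Lemma dual_lattice_int v j : dual_lattice v -> v 0 j \is a Num.int.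
Proof.
move=> /(_ (delta_mx j 0)); rewrite /pairing -colE mxE; apply.
by move=> i; rewrite mxE; case: (_ && _).
Qed.

Lemma dual_lattice0 : dual_lattice (0 : 'rV[R]_d).
Proof. by move=> x _; rewrite /pairing mul0mx mxE. Qed.

Lemma dual_latticeD u v :
  dual_lattice u -> dual_lattice v -> dual_lattice (u + v).
Proof. by move=> hu hv x xZ; rewrite pairingDl rpredD ?hu ?hv. Qed.

Lemma dual_latticeZ (m : int) v : dual_lattice v -> dual_lattice (m%:~R *: v).
Proof. by move=> hv x xZ; rewrite pairingZl rpredM ?hv ?rpred_int. Qed.

(** Avoids [sup] and [inf], so that seminorm estimates are checked pair by pair and make sense
    before boundedness is known. *)
Definition osc_le S t v := forall x y, S x -> S y -> `|pairing v (x - y)| <= t.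

Lemma osc_leP S t v : S !=set0 ->
  osc_le S t v <-> bounded_functionals S v /\ width S v <= t.
Proof.
move=> [x0 Sx0]; split=> [h|[[hu hl] hw] x y Sx Sy]; last first.
  have Px z : S z ->
      inf (pairing v @` S) <= pairing v z <= sup (pairing v @` S).
    move=> Sz; apply/andP; split; first by apply: ge_inf => //; exists z.
    by apply: ub_le_sup => //; exists z.
  rewrite pairingBr ler_norml; move: (Px _ Sx) (Px _ Sy) hw.
  rewrite /width; lra.
have {}h x y : S x -> S y -> pairing v x <= pairing v y + t.
  by move=> Sx Sy; have := h x y Sx Sy; rewrite pairingBr ler_norml; lra.
have ne : pairing v @` S !=set0 by exists (pairing v x0), x0.
split; first split.
- by exists (pairing v x0 + t) => _ [x Sx <-]; exact: h.
- exists (pairing v x0 - t) => _ [x Sx <-]; have := h _ _ Sx0 Sx; lra.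
rewrite /width lerBlDl; apply: ge_sup => // _ [x Sx <-].
rewrite -lerBlDr; apply: lb_le_inf => // _ [y Sy <-].
by rewrite lerBlDr; exact: h.
Qed.

Lemma osc_le_width S v : S !=set0 -> bounded_functionals S v ->
  osc_le S (width S v) v.
Proof. by move=> S0 bv; apply/osc_leP. Qed.

Lemma osc_le_weaken S s t v : s <= t -> osc_le S s v -> osc_le S t v.
Proof. by move=> st h x y Sx Sy; apply: le_trans st; exact: h. Qed.

Lemma osc_leD S s t u v :
  osc_le S s u -> osc_le S t v -> osc_le S (s + t) (u + v).
Proof.
move=> hu hv x y Sx Sy; rewrite pairingDl (le_trans (ler_normD _ _)) //.
by apply: lerD; [exact: hu|exact: hv].
Qed.

Lemma osc_leZ S t a v : osc_le S t v -> osc_le S (`|a| * t) (a *: v).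
Proof.
by move=> h x y Sx Sy; rewrite pairingZl normrM ler_wpM2l //; exact: h.
Qed.

Lemma osc_leN S t v : osc_le S t v -> osc_le S t (- v).
Proof. by move=> h x y Sx Sy; rewrite pairingNl normrN; exact: h. Qed.

Lemma osc_le0 S : osc_le S 0 0.
Proof. by move=> x y _ _; rewrite /pairing mul0mx mxE normr0. Qed.

Lemma osc_le_sum S k (t : 'I_k -> R) (v : 'I_k -> 'rV[R]_d) :
  (forall i, osc_le S (t i) (v i)) -> osc_le S (\sum_i t i) (\sum_i v i).
Proof.
move=> h; apply: (big_ind2 (fun s u => osc_le S s u)) => //.
  exact: osc_le0.
by move=> *; exact: osc_leD.
Qed.

Lemma osc_le_ge0 S t v : S !=set0 -> osc_le S t v -> 0 <= t.
Proof. by move=> [x Sx] /(_ x x Sx Sx); exact: le_trans. Qed.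

End pairing.

(** * The group of bounded lattice functionals and attainment of the lattice width *)

Section lattice.
Variables (R : realType) (d : nat) (S : set 'cV[R]_d).
Hypothesis S0 : S !=set0.
Implicit Types u v : 'rV[R]_d.

Let L := bounded_lattice_functionals S.

Lemma bounded_latticeE v : L v <-> dual_lattice v /\ exists t, osc_le S t v.
Proof.
split=> [[bv dv]|[dv [t /(osc_leP _ _ S0)[bv _]]]]; last by split.
by split => //; exists (width S v); exact: osc_le_width.
Qed.

Lemma bounded_latticeD u v : L u -> L v -> L (u + v).
Proof.
move=> /bounded_latticeE[du [s hu]] /bounded_latticeE[dv [t hv]].
apply/bounded_latticeE; split; first exact: dual_latticeD.
by exists (s + t); exact: osc_leD.
Qed.

Lemma bounded_latticeZ (m : int) v : L v -> L (m%:~R *: v).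
Proof.
move=> /bounded_latticeE[dv [t hv]].
apply/bounded_latticeE; split; first exact: dual_latticeZ.
by exists (`|m%:~R| * t); exact: osc_leZ.
Qed.

Lemma bounded_lattice0 : L 0.
Proof.
apply/bounded_latticeE; split; first exact: dual_lattice0.
by exists 0; exact: osc_le0.
Qed.

Lemma bounded_lattice_sum k (v : 'I_k -> 'rV[R]_d) (a : 'I_k -> int) :
  (forall i, L (v i)) -> L (\sum_i (a i)%:~R *: v i).
Proof.
move=> h; apply: (big_ind L) => [||i _]; first exact: bounded_lattice0.
  exact: bounded_latticeD.
exact: bounded_latticeZ.
Qed.

(** Approximating the coordinates of [u / T] yields [g] in [L] of oscillation below [w], so [g = 0].
    Freeness then kills all approximating integers, which leaves the coordinates of [u / T] below 1
    in absolute value. The bound [T] does not depend on [u]. *)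
Lemma lattice_coord_bound (w M : R) k (b : k.-tuple 'rV[R]_d) :
  0 < w -> (forall u t, L u -> u != 0 -> osc_le S t u -> w <= t) ->
  free b -> (forall i : 'I_k, L b`_i) -> 0 <= M ->
  exists C : R, forall u, L u -> u \in <<b>>%VS -> osc_le S M u ->
    forall i, `|coord b i u| <= C.
Proof.
move=> w0 wmin fb Lb M0.
pose B := \sum_(i < k) width S b`_i.
(* Fine enough for the total rounding error, at most [B / Q], to stay below [w / 2]. *)
pose Q := (Num.trunc (2 * B / w)).+1.
have Q0 : 0 < Q%:R :> R by rewrite ltr0n.
have BQ : Q%:R^-1 * B < w / 2.
  have := truncnS_gt (2 * B / w); rewrite -/Q ltr_pdivrMr // => h.
  by rewrite ltr_pdivrMl //; lra.
pose N : R := (Q ^ k)%:R.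
pose T := 2 * N * M / w + 1.
have NM0 : 0 <= N * M by rewrite mulr_ge0 ?ler0n.
(* The multiplier of [u / T] is at most [N], so this [T] keeps its share below [w / 2]; the summand
   1 gives strictness, also when [M = 0]. *)
have T0 : 0 < T by rewrite /T ltr_wpDl // divr_ge0 ?(ltW w0) // -mulrA mulr_ge0.
have NMT : N * M / T < w / 2.
  rewrite ltr_pdivrMr // /T mulrDr mulr1 mulrC [in ltRHS]mulrC.
  suff -> : 2 * N * M / w * (w / 2) = N * M by rewrite mulrC; lra.
  by field; rewrite gt_eqF.
exists T => u Lu ub uM.
pose c i := coord b i u / T.
have [n [a [/andP[n0 nN] na]]] := simultaneous_dirichlet c (isT : (0 < Q)%N).
pose g := \sum_(i < k) (a i)%:~R *: b`_i.
have Lg : L g by exact: bounded_lattice_sum.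
have gE : g = (n%:R / T) *: u +
    \sum_(i < k) (- (n%:R * c i - (a i)%:~R)) *: b`_i.
  rewrite [in X in _ *: X + _](coord_span ub) scaler_sumr -big_split /=.
  apply: eq_bigr => i _; rewrite scalerA -scalerDl; congr (_ *: _).
  by rewrite /c mulrA mulrAC; ring.
have oscg : osc_le S (`|n%:R / T| * M +
    \sum_(i < k) `|- (n%:R * c i - (a i)%:~R)| * width S b`_i) g.
  rewrite gE; apply: osc_leD; first exact: osc_leZ.
  apply: osc_le_sum => i; apply: osc_leZ; apply: osc_le_width => //.
  by have [] := Lb i.
have g0 : g = 0.
  apply/eqP/negPn/negP => gn0; have := wmin _ _ Lg gn0 oscg; apply/negP.
  rewrite -ltNge [ltRHS](splitr w); apply: ltr_leD.
    apply: le_lt_trans NMT; rewrite ger0_norm ?divr_ge0 ?(ltW T0) // mulrAC.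
    by rewrite ler_wpM2r ?invr_ge0 ?(ltW T0) // ler_wpM2r // ler_nat.
  apply: le_trans (ltW BQ); rewrite /B mulr_sumr; apply: ler_sum => i _.
  rewrite normrN ler_wpM2r ?(ltW (na i)) //.
  by apply: (osc_le_ge0 S0); apply: osc_le_width => //; have [] := Lb i.
move=> i; have /freeP/(_ (fun i => (a i)%:~R) g0 i) ai := fb.
have := na i; rewrite ai subr0 normrM ger0_norm // => h.
have c1 : `|c i| < 1.
  apply: le_lt_trans (lt_le_trans h _); last by rewrite invf_le1 // ler1n.
  by rewrite ler_peMl // ler1n.
move: c1; rewrite /c normrM normfV (gtr0_norm T0) ltr_pdivrMr // mul1r.
exact: ltW.
Qed.

(** Bounded coordinates in a free family spanning [L] bound the integer entries. Finiteness is
    stated through a map from a finite type, over which a minimum can be selected. *)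
Lemma bounded_lattice_finite (w M : R) :
  0 < w -> (forall u t, L u -> u != 0 -> osc_le S t u -> w <= t) -> 0 <= M ->
  exists n (dec : {ffun 'I_d -> 'I_n} -> 'rV[R]_d),
    forall u, L u -> osc_le S M u -> exists t, dec t = u.
Proof.
move=> w0 wmin M0.
have [k [b [fb Lb bL]]] := exists_free_spanning L.
have [C hC] := lattice_coord_bound w0 wmin fb Lb M0.
(* One bound for all entries; [|C|] keeps every summand nonnegative. *)
pose C' := \sum_(i < k) \sum_j `|C| * `|b`_i 0 j|.
pose n := (Num.trunc C').+1.
(* Digits from [0] to [2 n] encode entries from [- n] to [n]. *)
pose dec (t : {ffun 'I_d -> 'I_(n + n).+1}) : 'rV[R]_d :=
  \row_j ((t j)%:R - n%:R).
exists (n + n).+1, dec => u Lu uM.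
have u_le j : `|u 0 j| < n%:R.
  apply: le_lt_trans (truncnS_gt _).
  rewrite (coord_span (bL _ Lu)) summxE (le_trans (ler_norm_sum _ _ _)) //.
  apply: ler_sum => i _; rewrite mxE (bigD1 j) //= normrM.
  rewrite ler_wpDr ?sumr_ge0 //.
  rewrite ler_wpM2r // (le_trans (hC _ Lu (bL _ Lu) uM i)) //.
  exact: ler_norm.
have ui j : u 0 j \is a Num.int by apply: dual_lattice_int; case: Lu.
exists [ffun j => inord (absz (Num.floor (u 0 j) + n%:Z))].
apply/rowP => j; rewrite mxE ffunE.
have := u_le j; have := ui j; rewrite intrEfloor => /eqP.
set z := Num.floor _ => <-; rewrite ltr_norml => /andP[].
rewrite -[n%:R]/(n%:Z%:~R) -rmorphN !ltr_int => z1 z2.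
rewrite inordK; last by lia.
rewrite pmulrn -rmorphD /=; congr (_%:~R); lia.
Qed.

(** Finitely many codes cover all candidates no wider than a fixed nonzero [u0]; a minimiser among
    them is no wider than [u0], hence also beats all wider candidates. *)
Lemma lattice_width_attained : (0 < lattice_width S < +oo)%E ->
  exists2 u, L u /\ u != 0 & lattice_width S = (width S u)%:E.
Proof.
move=> /andP[lw0 lwoo].
have lw_le u : L u -> u != 0 -> (lattice_width S <= (width S u)%:E)%E.
  move=> Lu un0; apply: ereal_inf_lbound; exists u => //.
  by split => //; exact/eqP.
have lw_fin : lattice_width S \is a fin_num.
  by rewrite fin_numE; case: (lattice_width S) lw0 lwoo.
pose w := fine (lattice_width S).
have wE : lattice_width S = w%:E by rewrite fineK.
have w0 : 0 < w by rewrite -lte_fin -wE.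
have wmin u t : L u -> u != 0 -> osc_le S t u -> w <= t.
  move=> Lu un0 /(osc_leP _ _ S0)[_]; apply: le_trans.
  by rewrite -lee_fin -wE; exact: lw_le.
have [_ [u0 [Lu0 /eqP u00] _] _] := ereal_inf_lt lwoo.
have oscw u : L u -> osc_le S (width S u) u.
  by move=> [bu _]; exact: osc_le_width.
have M0 : 0 <= width S u0 by apply: (osc_le_ge0 S0); exact: oscw.
have [n [dec hdec]] := bounded_lattice_finite w0 wmin M0.
have [t0 t0E] := hdec u0 Lu0 (oscw _ Lu0).
(* A code may decode to zero or to a vector outside [L]. *)
pose P t := `[< L (dec t) /\ dec t != 0 >].
have Pt0 : P t0 by apply/asboolP; rewrite t0E.
case: (arg_minP (fun t => width S (dec t)) Pt0) => t /asboolP[Lt tn0] tmin.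
exists (dec t) => //; apply/eqP; rewrite eq_le lw_le //=.
apply: le_ereal_inf_tmp => _ [u [Lu /eqP un0] <-]; rewrite lee_fin.
have [uM|uM] := leP (width S u) (width S u0).
  have [s sE] : exists s, dec s = u.
    by apply: hdec => //; apply: osc_le_weaken uM _; exact: oscw.
  by rewrite -sE; apply: tmin; apply/asboolP; rewrite sE.
by apply: le_trans (ltW uM); rewrite -t0E; exact: tmin.
Qed.

End lattice.

(** * Convexity, symmetry and hulls *)

Section convex.
Variables (R : realType) (V : lmodType R).
Implicit Types (A K : set V) (x y : V) (t : R).

Lemma convex_setE A : convex_set A <->
  forall x y t, A x -> A y -> 0 <= t -> t <= 1 -> A (t *: x + (1 - t) *: y).
Proof.
split=> [cA x y t Ax Ay t0 t1|cA x y t /set_mem Ax /set_mem Ay].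
  by have := cA x y (Itv01 t0 t1) (mem_set Ax) (mem_set Ay) => /set_mem.
by apply/mem_set; apply: cA.
Qed.

Lemma convex_hull_convex A : convex_set (convex_hull A).
Proof.
apply/convex_setE => x y t hx hy t0 t1 B [cB AB].
by move/convex_setE: (cB); apply => //; [exact: hx|exact: hy].
Qed.

Lemma affine_hull_affine A : affine_set (affine_hull A).
Proof. by move=> x y t hx hy B [aB AB]; apply: (aB); [exact: hx|exact: hy]. Qed.

(** The reflected hull is convex and contains [A], hence contains the hull. *)
Lemma convex_hull_opp A : (forall x, A x -> A (- x)) ->
  forall x, convex_hull A x -> convex_hull A (- x).
Proof.
move=> AN; suff : convex_hull A `<=` [set x | convex_hull A (- x)] by [].
apply: smallest_sub => [|x Ax]; last by apply: sub_gen_smallest; exact: AN.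
apply/convex_setE => x y t /= hx hy t0 t1; rewrite opprD -!scalerN.
by have /convex_setE := @convex_hull_convex A; apply.
Qed.

(** Symmetry absorbs the signs, and convexity places [s K + t K] inside [(s + t) K]; a total factor
    at most 1 is then absorbed using [0]. *)
Lemma symmetric_convex_sum K k (b : 'I_k -> V) (c : 'I_k -> R) :
  convex_set K -> (forall x, K x -> K (- x)) -> K 0 -> (forall i, K (b i)) ->
  \sum_i `|c i| <= 1 -> K (\sum_i c i *: b i).
Proof.
move=> /convex_setE cK KN K0 Kb c1.
pose dil t v := 0 <= t /\ exists2 x, K x & v = t *: x.
have dilD s u t v : dil s u -> dil t v -> dil (s + t) (u + v).
  move=> [s0 [x Kx ->]] [t0 [y Ky ->]]; split; first exact: addr_ge0.
  (* If [s + t = 0], the weight [s / (s + t)] is unusable, but both vectors vanish. *)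
  have [st0|st0] := eqVneq (s + t) 0.
    have [-> ->] : s = 0 /\ t = 0 by lra.
    by exists 0; rewrite // !scale0r scaler0 addr0.
  exists ((s / (s + t)) *: x + (1 - s / (s + t)) *: y).
    apply: cK => //; first by rewrite divr_ge0 ?addr_ge0.
    by rewrite ler_pdivrMr ?mul1r ?lerDl // lt_neqAle eq_sym st0 addr_ge0.
  by rewrite scalerDr !scalerA; congr (_ *: _ + _ *: _); field.
have [s0 [x Kx ->]] : dil (\sum_i `|c i|) (\sum_i c i *: b i).
  apply: (big_ind2 dil) => [|*|i _]; last 1 first.
  - split=> //; have [ci|ci] := leP 0 (c i).
      by exists (b i); rewrite ?ger0_norm.
    by exists (- b i); [exact: KN|rewrite ltr0_norm // scalerN scaleNr opprK].
  - by split=> //; exists 0 => //; rewrite scaler0.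
  - exact: dilD.
by have := cK _ _ _ Kx K0 s0 c1; rewrite scaler0 addr0.
Qed.

End convex.

(** * Relative interior and closure against oscillation *)

Lemma relative_interior_sub (R : realType) (V : normedModType R) (A : set V) :
  relative_interior A `<=` A.
Proof. by move=> x [hx /nbhs_singleton]; exact. Qed.

(** In this form a coordinate is bounded by the sup norm through [normr_pairing_le]. *)
Lemma coord_pairing (R : realType) (d k : nat) (b : k.-tuple 'rV[R]_d) i v :
  coord b i v = pairing v (\col_j coord b i (delta_mx 0 j)).
Proof.
rewrite {1}[v]row_sum_delta linear_sum pairingE; apply: eq_bigr => j _.
by rewrite linearZ /= mxE.
Qed.

(** A basis [b] of the span of [A] is taken from [A]. Small vectors of that span, which contains the
    affine hull, have coordinates of absolute sum at most 1, so [symmetric_convex_sum] applies. *)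
Lemma symmetric_convex_hull_interior0 (R : realType) (d : nat)
    (A : set 'rV[R]_d) :
  A !=set0 -> (forall v, A v -> A (- v)) ->
  relative_interior (convex_hull A) 0.
Proof.
move=> [v0 Av0] AN; set K := convex_hull A.
have cK : convex_set K := @convex_hull_convex _ _ A.
have KN : forall v, K v -> K (- v) := convex_hull_opp AN.
have AK : A `<=` K := @sub_gen_smallest _ _ A.
have K0 : K 0.
  have /convex_setE/(_ v0 (- v0) 2^-1 (AK _ Av0) (KN _ (AK _ Av0))) := cK.
  rewrite (_ : 1 - 2^-1 = 2^-1); last by field.
  by rewrite scalerN subrr; apply; rewrite ?invr_ge0 // invf_le1 // ler1n.
split; first exact: sub_gen_smallest.
have [k [b [fb bA Ab]]] := exists_free_spanning A.
have Kb v : K v -> v \in <<b>>%VS.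
  suff : K `<=` [set v | v \in <<b>>%VS] by apply.
  apply: smallest_sub => //; apply/convex_setE => x y t /= xb yb _ _.
  by rewrite memvD ?memvZ.
have affb v : affine_hull K v -> v \in <<b>>%VS.
  suff : affine_hull K `<=` [set v | v \in <<b>>%VS] by apply.
  by apply: smallest_sub => // x y t /= xb yb; rewrite memvD ?memvZ.
pose z i : 'cV[R]_d := \col_j coord b i (delta_mx 0 j).
pose Z := \sum_i \sum_j `|z i j 0|.
have Z0 : 0 <= Z by apply: sumr_ge0 => i _; apply: sumr_ge0.
(* The coordinates have absolute sum at most [Z] times the sup norm; [Z + 1] avoids division by
   zero. *)
apply/nbhs_ballP; exists (Z + 1)^-1; first by rewrite /= invr_gt0 ltr_wpDl.
move=> v [_ hv] /affb vb; rewrite (coord_span vb).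
apply: symmetric_convex_sum => // [i|]; first by apply: AK; exact: bA.
apply: (@le_trans _ _ ((Z + 1)^-1 * Z)); last first.
  by rewrite ler_pdivrMl ?ltr_wpDl // mulr1 lerDl.
rewrite mulr_sumr; apply: ler_sum => i _; rewrite coord_pairing.
apply: normr_pairing_le => j; have := hv 0 j.
by rewrite mxE /ball /= sub0r normrN; exact: ltW.
Qed.

(** For fixed [x] and [y] the bound is a closed condition on [v]: a nearby [u] in [A] changes the
    pairing by at most [e]. *)
Lemma closure_osc_le (R : realType) (d : nat) (S : set 'cV[R]_d) (t : R)
    (A : set 'rV[R]_d) :
  (forall v, A v -> osc_le S t v) -> forall v, closure A v -> osc_le S t v.
Proof.
move=> At v cv x y Sx Sy; apply/ler_addgt0Pr => e e0.
pose Z := \sum_j `|(x - y) j 0|.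
have Z0 : 0 <= Z by exact: sumr_ge0.
have r0 : 0 < e / (Z + 1) by rewrite divr_gt0 // ltr_wpDl.
have [u [Au [_ hu]]] := cv _ (nbhsx_ballx v _ r0).
have -> : v = u + (v - u) by rewrite addrC subrK.
rewrite pairingDl (le_trans (ler_normD _ _)) // lerD ?(At _ Au) //.
apply: (@le_trans _ _ (e / (Z + 1) * Z)); last first.
  by rewrite mulrAC ler_pdivrMr ?ltr_wpDl // ler_wpM2l ?(ltW e0) // lerDl.
by apply: normr_pairing_le => j; rewrite !mxE; have := hu 0 j; exact: ltW.
Qed.

(** A slight dilation [(1 + a) u] stays in [K], so by homogeneity [u] has oscillation at most
    [t / (1 + a)]. *)
Lemma relative_interior_osc (R : realType) (d : nat) (S : set 'cV[R]_d) (t : R)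
    (K : set 'rV[R]_d) u :
  0 < t -> (forall v, K v -> osc_le S t v) -> K 0 -> relative_interior K u ->
  exists2 s, s < t & osc_le S s u.
Proof.
move=> t0 Kt K0 [hu /nbhs_ballP[e /= e0 he]].
pose n : R := `|u| + 1.
have n0 : 0 < n by rewrite ltr_wpDl.
(* Chosen so that [a |u| < e]. *)
pose a := e / n; have a0 : 0 < a by rewrite divr_gt0.
have a10 : 0 < 1 + a by rewrite ltr_wpDl.
have Ku : K ((1 + a) *: u).
  apply: he; last first.
    (* The dilated point is the affine combination of [u] and [0] with coefficients [1 + a] and
       [- a]. *)
    rewrite -[X in affine_hull _ X]addr0 -(scaler0 _ (1 - (1 + a))).
    by apply: affine_hull_affine => //; exact: sub_gen_smallest.
  rewrite -ball_normE /= scalerDl scale1r opprD addrA subrr sub0r normrN normrZ.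
  by rewrite gtr0_norm // /a mulrAC ltr_pdivrMr // ltr_pM2l // ltrDl.
exists ((1 + a)^-1 * t).
  by rewrite ltr_pdivrMl // ltr_pMl // ltrDl.
have -> : u = (1 + a)^-1 *: ((1 + a) *: u).
  by rewrite scalerA mulVf ?gt_eqF // scale1r.
rewrite -{1}(gtr0_norm (_ : 0 < (1 + a)^-1)) ?invr_gt0 //.
by apply: osc_leZ; exact: Kt.
Qed.

(** * The hull of the lattice width directions *)

Theorem theorem2p6 (R : realType) (d : nat) (S : set 'cV[R]_d) :
  S !=set0 ->
  (0 < lattice_width S)%E -> (lattice_width S < +oo)%E ->
  let K := convex_hull (lattice_width_directions S) in
  [/\ K !=set0,
      convex_set K,
      -%R @` K = K,
      @dual_lattice R d `&` relative_interior K = [set 0]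
    & @dual_lattice R d `&` relative_boundary K = lattice_width_directions S].
Proof.
move=> S0 lw0 lwoo; set D := lattice_width_directions S => K.
have [u0 [Lu0 u00] u0w] : exists2 u,
    bounded_lattice_functionals S u /\ u != 0 &
    lattice_width S = (width S u)%:E.
  by apply: lattice_width_attained => //; rewrite lw0.
set w := width S u0 in u0w.
have w0 : 0 < w by rewrite -lte_fin -u0w.
have lw_le v : bounded_lattice_functionals S v -> v <> 0 -> w <= width S v.
  by move=> Lv v0; rewrite -lee_fin -u0w; apply: ereal_inf_lbound; exists v.
(* Minimality of [w] turns the equality defining a direction into an upper bound, which survives
   convex combinations and limits. *)
have DE v : D v <-> [/\ dual_lattice v, v <> 0 & osc_le S w v].
  split=> [[[[bv dv] v0] vw]|[dv v0 vw]].
    by split=> //; apply/osc_leP => //; split=> //; rewrite -lee_fin vw u0w.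
  have Lv : bounded_lattice_functionals S v.
    by apply/bounded_latticeE => //; split => //; exists w.
  split=> //; rewrite u0w; congr (_%:E); apply/eqP.
  rewrite eq_le lw_le // andbT.
  by have /osc_leP[] := vw.
have DN v : D v -> D (- v).
  move=> /DE[dv v0 vw]; apply/DE; split; last exact: osc_leN.
    by rewrite -scaleN1r; exact: (dual_latticeZ (-1) dv).
  by move=> /eqP; rewrite oppr_eq0 => /eqP.
have D0 : D !=set0.
  by exists u0; split=> //; split => //; exact/eqP.
have DK : D `<=` K := @sub_gen_smallest _ _ D.
have KN : forall v, K v -> K (- v) := convex_hull_opp DN.
have ri0 : relative_interior K 0 by exact: symmetric_convex_hull_interior0.
have K0 : K 0 by exact: relative_interior_sub.
(* Sublevel sets of a seminorm are convex, so the bound passes from [D] to its hull. *)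
have Kw v : K v -> osc_le S w v.
  suff : K `<=` [set v | osc_le S w v] by apply.
  apply: smallest_sub => [|x /DE[]//].
  apply/convex_setE => x y t /= xw yw t0 t1.
  rewrite (_ : w = `|t| * w + `|1 - t| * w).
    by apply: osc_leD; exact: osc_leZ.
  by rewrite !ger0_norm ?subr_ge0 //; ring.
have ri_lattice v : dual_lattice v -> relative_interior K v -> v = 0.
  move=> dv riv; apply: contrapT => v0.
  have [s sw /osc_leP[//|bv vs]] := relative_interior_osc w0 Kw K0 riv.
  by have := lw_le v (conj bv dv) v0; lra.
split.
- by have [v Dv] := D0; exists v; exact: DK.
- exact: convex_hull_convex.
- apply/seteqP; split=> [_ [v Kv <-]|v Kv]; first exact: KN.
  by exists (- v); [exact: KN|rewrite opprK].
- apply/seteqP; split=> [v [dv riv]|_ ->]; first exact: ri_lattice.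
  by split => //; exact: dual_lattice0.
- apply/seteqP; split=> [v [dv [cv nriv]]|v Dv].
    (* A boundary point is nonzero because the origin is relatively interior, and the closure keeps
       the bound [w]. *)
    apply/DE; split=> //; first by move=> v0; apply: nriv; rewrite v0.
    exact: closure_osc_le cv.
  have [dv v0 _] := (DE v).1 Dv; split=> //.
  split; last by move/(ri_lattice _ dv).
  by apply: subset_closure; exact: DK.
Qed.
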